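(* For every rooted tree $T$: (i) $\binom{i}{T}=|\mathscr{D}(T,i)|$ for all $i\in\mathbb{N}$, and $\binom{t}{T}$ is the unique polynomial with this property; (ii) $\binom{t}{T}=\sum_{k=h(T)}^{|T|-1}|\mathscr{D}^c(T,k)|\binom{t}{k}$, where $\binom{t}{k}=\frac{t(t-1)\cdots(t-k+1)}{k!}$; (iii) $B_T=\sum_{k=h(T)}^{|T|-1}\frac{(-1)^k}{k+1}|\mathscr{D}^c(T,k)|$.
   Context: $\mathbb{K}$ is a field of characteristic zero. $\mathcal{T}=\prod_{n\ge1}\mathcal{T}(n)$, $\mathcal{T}(n)$ spanned by isomorphism classes of (non-planar) rooted trees with $n$ vertices, with pre-Lie product $T\curvearrowright T'=\sum_{v\in V(T')}T\searrow_vT'$ ($T\searrow_vT'$: add an edge from the root of $T$ to the vertex $v$ of $T'$, keep the root of $T'$); $\bullet$ is the one-vertex tree. With $B_k$ the Bernoulli numbers and $\langle\frac{D}{e^D-1}|\cdot\rangle$ the functional $t^n\mapsto B_n$ (extended coefficientwise), let $P=\sum_TP(T)(t)T$ be the solution of $P'=\langle\frac{D}{e^D-1}|P\rangle\curvearrowright P$, $P(0)=\bullet$; set $\binom{t}{T}=|\mathrm{Aut}(T)|P(T)(t)$ and $B_T=\langle\frac{D}{e^D-1}|\binom{t}{T}\rangle$. $|T|$ is the number of vertices of $T$, and $h(T)$ the maximal distance (number of edges) of a vertex from the root. A vertex $v'$ is a descendant of $v$ if $v$ lies on the path from $v'$ to the root. A decreasing decoration of $T$ is a map $d\colon V(T)\to\mathbb{N}$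 with $d(v)>d(v')$ whenever $v'\ne v$ is a descendant of $v$; it is complete if its image is $\{0,1,\ldots,k\}$ for some $k$. $\mathscr{D}(T,i)$ (resp. $\mathscr{D}^c(T,i)$) is the set of (resp. complete) decreasing decorations assigning $i$ to the root. *)

(* Defs.v *)
From HB Require Import structures.
From mathcomp Require Import all_boot all_order all_algebra generic_quotient.

Set Implicit Arguments.
Unset Strict Implicit.
Unset Printing Implicit Defensive.

Import GRing.Theory.
Local Open Scope ring_scope.
Local Open Scope quotient_scope.

(* A rooted tree with vertex set V is encoded as (root, parent map).  The     *)
(* parent of the root is, by convention, the root itself; the remaining edges *)
(* of the tree are the pairs {v, parent v} with v != root.                    *)
Definition is_rtree (V : finType) (t : V * {ffun V -> V}) : bool :=
  (t.2 t.1 == t.1) && [forall v, fconnect t.2 v t.1].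

Record rtree (V : finType) := RTree {
  rtree_val : V * {ffun V -> V};
  _ : is_rtree rtree_val }.

HB.instance Definition _ (V : finType) := [isSub for @rtree_val V].
HB.instance Definition _ (V : finType) := [Finite of rtree V by <:].

Definition troot (V : finType) (T : rtree V) : V := (rtree_val T).1.
Definition parent (V : finType) (T : rtree V) : {ffun V -> V} := (rtree_val T).2.

Definition is_iso (V W : finType) (T : rtree V) (T' : rtree W)
    (f : {ffun V -> W}) : bool :=
  [&& injectiveb f, [forall w, w \in codom f], f (troot T) == troot T'
    & [forall v, f (parent T v) == parent T' (f v)]].

Definition isomorphic (V W : finType) (T : rtree V) (T' : rtree W) : bool :=
  [exists f, is_iso T T' f].

Definition tree_aut (V : finType) (T : rtree V) : {set {ffun V -> V}} :=
  [set f | is_iso T T f].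

Lemma isomorphic_refl (V : finType) (T : rtree V) : isomorphic T T.
Proof.
apply/existsP; exists [ffun v => v]; apply/and4P; split.
- by apply/injectiveP => x y; rewrite !ffunE.
- by apply/forallP => w; apply/codomP; exists w; rewrite ffunE.
- by rewrite ffunE.
- by apply/forallP => v; rewrite !ffunE.
Qed.

Lemma isomorphic_sym (V W : finType) (T : rtree V) (T' : rtree W) :
  isomorphic T T' -> isomorphic T' T.
Proof.
case/existsP => f /and4P[/injectiveP fI /forallP fS /eqP fr /forallP fp].
pose g := [ffun w => iinv (fS w)].
have fK : cancel g f by move=> w; rewrite ffunE f_iinv.
have gK : cancel f g by move=> v; apply: fI; rewrite fK.
apply/existsP; exists g; apply/and4P; split.
- by apply/injectiveP; apply: can_inj fK.
- by apply/forallP => v; apply/codomP; exists (f v); rewrite gK.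
- by rewrite -fr gK.
- by apply/forallP => w; apply/eqP/fI; rewrite (eqP (fp _)) !fK.
Qed.

Lemma isomorphic_trans (V1 V2 V3 : finType)
    (T1 : rtree V1) (T2 : rtree V2) (T3 : rtree V3) :
  isomorphic T1 T2 -> isomorphic T2 T3 -> isomorphic T1 T3.
Proof.
case/existsP => f /and4P[/injectiveP fI /forallP fS /eqP fr /forallP fp].
case/existsP => g /and4P[/injectiveP gI /forallP gS /eqP gr /forallP gp].
apply/existsP; exists [ffun v => g (f v)]; apply/and4P; split.
- by apply/injectiveP => x y; rewrite !ffunE => /gI /fI.
- apply/forallP => w; have /codomP[v ->] := gS w; have /codomP[u ->] := fS v.
  by apply/codomP; exists u; rewrite ffunE.
- by rewrite ffunE fr gr.
- by apply/forallP => v; rewrite !ffunE (eqP (fp _)) (eqP (gp _)).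
Qed.

Definition iso_rel n : rel (rtree 'I_n) := fun T T' => isomorphic T T'.

Lemma iso_rel_equiv n : equiv_class_of (@iso_rel n).
Proof.
split; first exact: isomorphic_refl.
- by move=> T T'; apply/idP/idP; apply: isomorphic_sym.
- by move=> T2 T1 T3; apply: isomorphic_trans.
Qed.

Canonical iso_equiv n := EquivRelPack (iso_rel_equiv n).

(* Isomorphism classes of rooted trees with n vertices; empty for n = 0. *)
Definition tree_class n : Type := {eq_quot iso_equiv n}.
HB.instance Definition _ n := EqQuotient.on (tree_class n).
HB.instance Definition _ n := Choice.on (tree_class n).
HB.instance Definition _ n : isCountable (tree_class n) :=
  CanIsCountable (@reprK _ (tree_class n)).
HB.instance Definition _ n : isFinite (tree_class n) :=
  CanIsFinite (@reprK _ (tree_class n)).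

(* The edge added to the disjoint union joins the root of T1 to v : V(T2). *)
Definition graft_val (V1 V2 : finType) (T1 : rtree V1) (v : V2) (T2 : rtree V2)
    : (V1 + V2) * {ffun V1 + V2 -> V1 + V2} :=
  (inr (troot T2),
   [ffun x => match x with
              | inl u => if u == troot T1 then inr v else inl (parent T1 u)
              | inr w => inr (parent T2 w)
              end]).

Lemma graft_subproof (V1 V2 : finType) (T1 : rtree V1) (v : V2) (T2 : rtree V2) :
  is_rtree (graft_val T1 v T2).
Proof.
have [/andP[/eqP r1 /forallP c1] /andP[/eqP r2 /forallP c2]] :
  is_rtree (rtree_val T1) /\ is_rtree (rtree_val T2) by split; apply: valP.
rewrite /is_rtree /=; set p := finfun _.
have pr w : p (inr w) = inr (parent T2 w) by rewrite ffunE.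
have Cr w : fconnect p (inr w) (inr (troot T2)).
  have /iter_findex <- : fconnect (parent T2) w (troot T2) := c2 w.
  elim: (findex (parent T2) w (troot T2)) => //= k IHk; apply: connect_trans IHk _.
  by rewrite -pr fconnect1.
rewrite pr /parent r2 eqxx; apply/forallP => -[u|w] //.
have /iter_findex : fconnect (parent T1) u (troot T1) := c1 u.
move: (findex (parent T1) u (troot T1)) => k; elim: k u => [|k IHk] u E.
  apply: connect_trans (Cr v); rewrite /= in E.
  have <- : p (inl u) = inr v by rewrite ffunE E eqxx.
  exact: fconnect1.
case: (eqVneq u (troot T1)) => [Eu|Nu].
  apply: connect_trans (Cr v).
  have <- : p (inl u) = inr v by rewrite ffunE Eu eqxx.
  exact: fconnect1.
rewrite iterSr in E; apply: connect_trans (IHk _ E).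
have <- : p (inl u) = inl (parent T1 u) by rewrite ffunE (negbTE Nu).
exact: fconnect1.
Qed.

Definition graft (V1 V2 : finType) (T1 : rtree V1) (v : V2) (T2 : rtree V2)
  : rtree (V1 + V2)%type := RTree (graft_subproof T1 v T2).

Lemma single_subproof : is_rtree (tt, [ffun x : unit => x]).
Proof.
apply/andP; split; first by apply/eqP; exact: (ffunE (fun x : unit => x) tt).
by apply/forallP => -[]; exact: connect0.
Qed.

Definition single_vertex : rtree unit := RTree single_subproof.

(* Elements of prod_n T(n), with coefficients in R: families of coefficients  *)
(* indexed by isomorphism classes.                                            *)
Definition tree_series (R : Type) := forall n, tree_class n -> R.

Definition tree_elt (R : nzRingType) (V : finType) (T : rtree V) : tree_series R :=
  fun n c => (isomorphic T (repr c))%:R.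

Definition bullet (R : nzRingType) : tree_series R := tree_elt R single_vertex.
Arguments bullet R n c : clear implicits.

(* Only pairs with n1 + n2 = n contribute to the degree n component, since    *)
(* tree_elt of a tree with n1 + n2 vertices vanishes on tree_class n          *)
(* otherwise; hence the finite summation bounds.                              *)
Definition prelie (R : nzRingType) (f g : tree_series R) : tree_series R :=
  fun n c =>
    \sum_(n1 < n.+1) \sum_(n2 < n.+1)
      \sum_(c1 : tree_class n1) \sum_(c2 : tree_class n2)
        f n1 c1 * g n2 c2 *
          \sum_(v : 'I_n2) tree_elt R (graft (repr c1) v (repr c2)) c.

Section Bernoulli.
Variable K : fieldType.

(* [:: B_0; ...; B_(n-1)], from sum_(k <= m) binomial(m+1, k) B_k = [m = 0]. *)
Fixpoint bernoulli_seq (n : nat) : seq K :=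
  if n is m.+1 then
    let s := bernoulli_seq m in
    rcons s (((m == 0)%:R - \sum_(k < m) 'C(m.+1, k)%:R * s`_k) / m.+1%:R)
  else [::].

Definition bernoulli (n : nat) : K := (bernoulli_seq n.+1)`_n.

(* The functional <D/(e^D-1) | . >. *)
Definition todd (p : {poly K}) : K := \sum_(i < size p) p`_i * bernoulli i.

Definition tree_solution (P : tree_series {poly K}) : Prop :=
  (forall n (c : tree_class n),
     (P n c)^`() = prelie (fun m c' => (todd (P m c'))%:P) P c)
  /\ (forall n (c : tree_class n), (P n c).[0] = bullet K n c).

Definition tree_binom (P : tree_series {poly K}) n (T : rtree 'I_n) : {poly K} :=
  #|tree_aut T|%:R *: P n (\pi_(tree_class n) T).

Definition tree_bernoulli (P : tree_series {poly K}) n (T : rtree 'I_n) : K :=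
  todd (tree_binom P T).

Definition poly_binom (k : nat) : {poly K} :=
  k`!%:R^-1 *: \prod_(i < k) ('X - i%:R%:P).

End Bernoulli.

Arguments poly_binom K k : clear implicits.
Arguments bernoulli K n : clear implicits.

Section Decorations.
Variables (V : finType) (T : rtree V).

(* findex is the least number of parent steps leading from v to the root. *)
Definition tree_height : nat := \max_(v : V) findex (parent T) v (troot T).

Definition descendant (v' v : V) : bool := fconnect (parent T) v' v.

Definition decreasing (d : V -> nat) : bool :=
  [forall v, forall v', (v' != v) && descendant v' v ==> (d v' < d v)%N].

(* Decreasing decorations V -> nat with value i at the root take values in    *)
(* {0, ..., i} (see mem_decorations), hence the codomain 'I_i.+1.             *)
Definition decorations (i : nat) : {set {ffun V -> 'I_i.+1}} :=
  [set d : {ffun V -> 'I_i.+1} |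
    decreasing (fun v => d v : nat) && (d (troot T) == i :> nat)].

Definition complete (i : nat) (d : {ffun V -> 'I_i.+1}) : bool :=
  [exists k : 'I_i.+1, [forall m : 'I_i.+1, (m \in codom d) == (m <= k)%N]].

Definition complete_decorations (i : nat) : {set {ffun V -> 'I_i.+1}} :=
  [set d in decorations i | complete d].

Lemma mem_decorations (i : nat) (d : V -> nat) :
  (decreasing d /\ d (troot T) = i) <->
  (exists2 d', d' \in decorations i & forall v, d v = d' v).
Proof.
split=> [[dd dr]|[d']]; last first.
  rewrite inE => /andP[dd /eqP dr] E; rewrite E; split=> //.
  apply/forallP => v; apply/forallP => v'; apply/implyP => H; rewrite !E.
  by move/forallP/(_ v)/forallP/(_ v')/implyP: dd; apply.
have le v : (d v < i.+1)%N.
  case: (eqVneq v (troot T)) => [->|N]; first by rewrite dr.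
  move/forallP/(_ (troot T))/forallP/(_ v)/implyP: dd => dd.
  rewrite -dr ltnS ltnW // dd // N /=.
  by have /andP[_ /forallP] := valP T; apply.
exists [ffun v => Ordinal (le v)] => [|v]; last by rewrite ffunE.
rewrite inE ffunE /= dr eqxx andbT.
apply/forallP => v; apply/forallP => v'; rewrite !ffunE /=.
by move/forallP/(_ v)/forallP/(_ v'): dd.
Qed.

End Decorations.

Section Char0.
Variable K : fieldType.
Hypothesis char0 : [pchar K] =i pred0.

Lemma char0_natS_neq0 n : n.+1%:R != 0 :> K.
Proof. by rewrite (proj1 (pcharf0P K) char0). Qed.

Lemma size_bernoulli_seq n : size (bernoulli_seq K n) = n.
Proof. by elim: n => //= n IHn; rewrite size_rcons IHn. Qed.

Lemma nth_bernoulli_seq n k : (k < n)%N -> (bernoulli_seq K n)`_k = bernoulli K k.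
Proof.
elim: n => // n IHn; rewrite ltnS leq_eqVlt => /predU1P[->//|lt_kn].
by rewrite [LHS]nth_rcons size_bernoulli_seq lt_kn IHn.
Qed.

(* sum_k B_k x^k / k! is the inverse of (e^x - 1) / x. *)
Lemma bernoulli_generating n :
  \sum_(k < n.+1) bernoulli K k / k`!%:R * (n.+1 - k)`!%:R^-1 = (n == 0)%:R.
Proof.
have fN0 m : m`!%:R != 0 :> K by rewrite -(prednK (fact_gt0 m)) char0_natS_neq0.
have -> : \sum_(k < n.+1) bernoulli K k / k`!%:R * (n.+1 - k)`!%:R^-1
   = (n.+1)`!%:R^-1 * \sum_(k < n.+1) 'C(n.+1, k)%:R * bernoulli K k.
  rewrite mulr_sumr; apply: eq_bigr => k _.
  have le_kn : (k <= n.+1)%N by rewrite ltnW.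
  apply: (mulfI (fN0 n.+1)); rewrite [RHS]mulVKf //.
  rewrite -(bin_fact le_kn) !natrM -[LHS]mulrA; congr (_ * _).
  by rewrite mulrACA mulfV // mulr1 mulrC divfK.
rewrite big_ord_recr /= [bernoulli K n]/bernoulli /= nth_rcons.
rewrite size_bernoulli_seq ltnn eqxx binSn [n.+1%:R * _]mulrC divfK ?char0_natS_neq0 //.
rewrite [X in _ - X](eq_bigr (fun k : 'I_n => 'C(n.+1, k)%:R * bernoulli K k)).
  by rewrite addrC subrK; case: n => [|n] /=; rewrite ?mulr0 // mulr1 invr1.
by move=> k _; rewrite nth_bernoulli_seq.
Qed.

Lemma graft_card (n1 n2 n : nat) (T1 : rtree 'I_n1) (v : 'I_n2) (T2 : rtree 'I_n2)
    (T : rtree 'I_n) :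
  isomorphic (graft T1 v T2) T -> (n1 + n2)%N = n.
Proof.
case/existsP => h /and4P[/injectiveP hI /forallP hS _ _].
have /bij_eq_card : bijective h.
  exists (fun w => iinv (hS w)) => x; last exact: f_iinv.
  by apply: hI; rewrite f_iinv.
by rewrite card_sum !card_ord.
Qed.

Lemma rtree_card_gt0 n (T : rtree 'I_n) : (0 < n)%N.
Proof. by case: (troot T) => m; apply: leq_ltn_trans. Qed.

(* prelie in degree n only involves its arguments in degrees < n. *)
Lemma eq_prelie (R : nzRingType) (f f' g g' : tree_series R) n :
    (forall m (c : tree_class m), (m < n)%N -> f m c = f' m c) ->
    (forall m (c : tree_class m), (m < n)%N -> g m c = g' m c) ->
  forall c : tree_class n, prelie f g c = prelie f' g' c.
Proof.
move=> Ef Eg c; rewrite /prelie.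
apply: eq_bigr => n1 _; apply: eq_bigr => n2 _.
apply: eq_bigr => c1 _; apply: eq_bigr => c2 _.
have [E|nE] := eqVneq (n1 + n2)%N n; last first.
  rewrite big1 ?mulr0 // => v _; rewrite /tree_elt.
  by case: (boolP (isomorphic _ _)) => // /graft_card E; rewrite E eqxx in nE.
have n1_gt0 := rtree_card_gt0 (repr c1); have n2_gt0 := rtree_card_gt0 (repr c2).
rewrite Ef ?Eg // -[X in (_ < X)%N]E.
  by rewrite -[X in (X < _)%N]add0n ltn_add2r.
by rewrite -[X in (X < _)%N]addn0 ltn_add2l.
Qed.

Definition primitive (p : {poly K}) : {poly K} :=
  \poly_(i < (size p).+1) (p`_i.-1 / i%:R * (i != 0)%:R).

Lemma primitive_deriv p : (primitive p)^`() = p.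
Proof.
apply/polyP => i; rewrite coef_deriv coef_poly ltnS.
have [lt_ip|/(nth_default 0)->] := ltnP i (size p); last by rewrite mul0rn.
by rewrite /= mulr1 -[LHS]mulr_natr divfK // char0_natS_neq0.
Qed.

Lemma primitive_at0 p : (primitive p).[0] = 0.
Proof. by rewrite horner_coef0 coef_poly /= mulr0. Qed.

Lemma deriv_at0_inj (p q : {poly K}) : p^`() = q^`() -> p.[0] = q.[0] -> p = q.
Proof.
rewrite !horner_coef0 => Ed E0; apply/polyP => -[|i] //.
have /polyP/(_ i) := Ed.
rewrite !coef_deriv -[LHS]mulr_natr -[RHS]mulr_natr.
by move/(mulIf (char0_natS_neq0 i)).
Qed.

Lemma tree_solution_unique (P Q : tree_series {poly K}) :
  tree_solution P -> tree_solution Q -> forall n (c : tree_class n), P n c = Q n c.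
Proof.
move=> [dP P0] [dQ Q0] n; have [m] := ubnP n.
elim: m n => // m IHm n le_nm c; apply: deriv_at0_inj; last by rewrite P0 Q0.
by rewrite dP dQ; apply: eq_prelie => k c' lt_kn; rewrite IHm // (leq_trans lt_kn).
Qed.

Definition picard (P : tree_series {poly K}) : tree_series {poly K} := fun n c =>
  (bullet K n c)%:P + primitive (prelie (fun m c' => (todd (P m c'))%:P) P c).

Lemma tree_solution_exists : exists P : tree_series {poly K}, tree_solution P.
Proof.
pose F k : tree_series {poly K} := iter k picard (fun _ _ => 0).
have stable n k l (c : tree_class n) : (n < k)%N -> (n < l)%N -> F k n c = F l n c.
  elim/ltn_ind: n k l c => n IHn [|k] // [|l] // c; rewrite !ltnS => le_nk le_nl.
  rewrite /F /= /picard; congr (_ + primitive _).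
  by apply: eq_prelie => m c' lt_mn; rewrite -/(F k) -/(F l);
     rewrite (IHn m lt_mn k l c') // (leq_trans lt_mn).
exists (fun n => F n.+1 n); split => n c; rewrite /F /= /picard.
  rewrite derivD derivC add0r primitive_deriv.
  by apply: eq_prelie => m c' lt_mn; rewrite -/(F n) (stable m n m.+1).
by rewrite hornerD hornerC primitive_at0 addr0.
Qed.

End Char0.

(* Main.v *)
Require Import Defs.
From HB Require Import structures.
From mathcomp Require Import all_boot all_order all_algebra generic_quotient.
From mathcomp Require Import ring.
Import GRing.Theory.
Local Open Scope ring_scope.
Local Open Scope quotient_scope.

Set Implicit Arguments.
Unset Strict Implicit.
Unset Printing Implicit Defensive.

(* Write S for the indefinite sum operator on polynomials, (S p)(n) being the
   sum of the p(m) for m < n; it is the antiderivative, vanishing at 0, of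
   D/(e^D - 1) p.  Hence (S p)' = S p' + <D/(e^D - 1)|p>.  If F_T(i) is the
   number of decreasing decorations of T with value i at the root, then F_T is
   the product of the S F_{T_j} over the branches T_j of the root.  By
   induction, F_T' is the sum, over the edges e of T, of <D/(e^D - 1)|F_U>
   F_W, where U and W are the components of T without e, the root of T lying
   in W.  Counting the isomorphisms from a grafting onto T by the edge to
   which they send the new edge turns this into the differential equation for
   F_T / |Aut T|, and uniqueness of its solution gives (i).  A decreasing
   decoration is a complete one followed by an increasing bijection onto its
   image, hence (ii); and S maps the binomial polynomial of degree k to that
   of degree k + 1, whose linear coefficient is (-1)^k / (k + 1), hence (iii). *)

(** * Indefinite sums of polynomials *)
Section PolynomialSums.

Variable K : fieldType.
Hypothesis char0 : [pchar K] =i pred0.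
Implicit Types (p q : {poly K}) (x : K).

Lemma char0_natr_inj (m n : nat) : m%:R = n%:R :> K -> m = n.
Proof.
wlog le_mn : m n / (m <= n)%N => [W E|E].
  by case/orP: (leq_total m n) => /W H; [exact: H | rewrite H].
apply/eqP; rewrite eqn_leq le_mn /= -subn_eq0.
by rewrite -(proj1 (pcharf0P K) char0) natrB // E subrr.
Qed.

Lemma char0_fact_neq0 (n : nat) : n`!%:R != 0 :> K.
Proof. by rewrite -(prednK (fact_gt0 n)) char0_natS_neq0. Qed.

(** In characteristic zero the naturals are distinct in K, so [p - q] has at least as many roots as
    its size. Polynomial identities below thus reduce to counting identities. *)
Lemma eq_poly_nat p q : (forall n : nat, p.[n%:R] = q.[n%:R]) -> p = q.
Proof.
move=> E; apply/eqP; rewrite -subr_eq0; apply/eqP.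
apply: (@roots_geq_poly_eq0 _ _ [seq n%:R | n <- iota 0 (size (p - q))]).
- by apply/allP => _ /mapP[n _ ->]; rewrite rootE hornerD hornerN E subrr.
- by rewrite map_inj_uniq ?iota_uniq // => m n /char0_natr_inj.
- by rewrite size_map size_iota.
Qed.

(** The operator D/(e^D - 1) itself, as the series of the B_k D^k / k!; derivatives of order
    [size p] and above vanish. *)
Definition todd_op p : {poly K} :=
  \sum_(k < size p) (bernoulli K k / k`!%:R) *: p^`(k).

Lemma todd_opE N p : (size p <= N)%N ->
  todd_op p = \sum_(k < N) (bernoulli K k / k`!%:R) *: p^`(k).
Proof.
move=> le_pN; rewrite /todd_op.
rewrite (big_ord_widen N (fun k => (bernoulli K k / k`!%:R) *: p^`(k))) //.
rewrite big_mkcond /=; apply: eq_bigr => k _.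
by case: ltnP => // /derivn_poly0 ->; rewrite scaler0.
Qed.

Lemma todd_op_at0 p : (todd_op p).[0] = todd p.
Proof.
rewrite /todd_op horner_sum; apply: eq_bigr => k _.
rewrite hornerZ horner_coef0 coef_derivn addn0 ffactnn -[p`_k *+ _]mulr_natr.
by rewrite mulrA mulrAC divfK ?char0_fact_neq0 // mulrC.
Qed.

Lemma deriv_todd_op p : (todd_op p)^`() = todd_op p^`().
Proof.
rewrite (@todd_opE (size p) p^`()); last exact: leq_trans (size_poly _ _) (leq_pred _).
rewrite /todd_op raddf_sum; apply: eq_bigr => k _ /=.
by rewrite derivZ -derivnS derivSn.
Qed.

(** The operator S, formally 1/(e^D - 1): a right inverse of the forward difference. *)
Definition psum p : {poly K} := primitive (todd_op p).

Lemma deriv_psum p : (psum p)^`() = todd_op p.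
Proof. exact: primitive_deriv. Qed.

Lemma psum_at0 p : (psum p).[0] = 0.
Proof. exact: primitive_at0. Qed.

Lemma deriv_psum_at0 p : (psum p)^`().[0] = todd p.
Proof. by rewrite deriv_psum todd_op_at0. Qed.

(** Taylor's formula, the shift by 1 being e^D; the free bound [N] allows a common truncation of
    several series. *)
Lemma horner_add1 N p x : (size p <= N)%N ->
  p.[x + 1] = \sum_(i < N) p^`(i).[x] / i`!%:R.
Proof.
move=> le_pN; rewrite nderiv_taylor; last exact: mulrC.
have -> : \sum_(i < size p) p^`N(i).[x] * 1 ^+ i
        = \sum_(i < size p) p^`(i).[x] / i`!%:R.
  apply: eq_bigr => i _; rewrite expr1n mulr1 nderivn_def hornerMn -mulr_natr.
  by rewrite mulfK ?char0_fact_neq0.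
rewrite (big_ord_widen N (fun i => p^`(i).[x] / i`!%:R)) //.
rewrite big_mkcond /=; apply: eq_bigr => k _.
by case: ltnP => // /derivn_poly0 ->; rewrite horner0 mul0r.
Qed.

(* As operators, (e^D - 1)/D composed with D/(e^D - 1) is the identity. *)
Lemma psum_add1 p x : (psum p).[x + 1] = (psum p).[x] + p.[x].
Proof.
set N := size p.
have szS : (size (psum p) <= N.+1)%N.
  rewrite /psum /primitive; apply: leq_trans (size_poly _ _) _; rewrite ltnS.
  apply/leq_sizeP => j le_j; rewrite coef_sum big1 // => k _.
  by rewrite coefZ coef_derivn nth_default ?mul0rn ?mulr0 // (leq_trans le_j) ?leq_addl.
rewrite (horner_add1 x szS) big_ord_recl /= fact0 divr1; congr (_ + _).
(* Here k is the Bernoulli index and j = i + k the total order of differentiation, i + 1 being the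
   Taylor order. Terms with j >= N vanish, so for fixed k only k <= j < N remains. *)
pose F k j := (bernoulli K k / k`!%:R * (j.+1 - k)`!%:R^-1) * p^`(j).[x].
transitivity (\sum_(k < N) \sum_(j < N | (k <= j)%N) F k j).
  under eq_bigr => i _.
    rewrite -[bump 0 i]/(i.+1) add0n -derivnS derivSn deriv_psum (@todd_opE N p) //.
    rewrite raddf_sum horner_sum mulr_suml.
    under eq_bigr => k _ do rewrite /= derivnZ hornerZ {1 2}/derivn -iterD -/(derivn _ _).
    over.
  rewrite exchange_big /=; apply: eq_bigr => k _.
  transitivity (\sum_(k <= j < N + k) F k j).
    have := @big_addn K 0 +%R 0 (N + k) k xpredT (F k).
    rewrite add0n addnK big_mkord => ->.
    by apply: eq_bigr => i _; rewrite /F -addSn addnK mulrAC.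
  rewrite (big_cat_nat (n := N)) ?leq_addr //=; last exact: ltnW.
  rewrite [X in _ + X]big1_seq ?addr0; last first.
    move=> j /=; rewrite mem_index_iota => /andP[le_Nj _].
    by rewrite /F derivn_poly0 // horner0 mulr0.
  by rewrite (big_nat_widenl _ 0) // big_mkord.
rewrite (exchange_big_dep predT) //=.
(* For fixed j the sum over k <= j is the one in [bernoulli_generating], which leaves only j = 0. *)
transitivity (\sum_(j < N) (j == 0 :> nat)%:R * p^`(j).[x]).
  apply: eq_bigr => j _; rewrite -(bernoulli_generating char0) mulr_suml.
  by rewrite (big_ord_widen N (fun k => F k j)).
rewrite /N; case szp: (size p) => [|m].
  by rewrite big_ord0; move/eqP: szp; rewrite size_poly_eq0 => /eqP->; rewrite horner0.
by rewrite big_ord_recl /= mul1r big1 ?addr0 // => i _; rewrite mul0r.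
Qed.

Lemma psum_nat p (n : nat) : (psum p).[n%:R] = \sum_(m < n) p.[m%:R].
Proof.
elim: n => [|n IHn]; first by rewrite psum_at0 big_ord0.
by rewrite -addn1 natrD psum_add1 IHn addn1 big_ord_recr.
Qed.

Lemma psumZ a p : psum (a *: p) = a *: psum p.
Proof.
apply: eq_poly_nat => n; rewrite hornerZ !psum_nat mulr_sumr.
by apply: eq_bigr => m _; rewrite hornerZ.
Qed.

Lemma psum_sum I (r : seq I) (Q : pred I) (F : I -> {poly K}) :
  psum (\sum_(i <- r | Q i) F i) = \sum_(i <- r | Q i) psum (F i).
Proof.
apply: eq_poly_nat => n; rewrite horner_sum psum_nat.
under eq_bigr => m _ do rewrite horner_sum.
by rewrite exchange_big; apply: eq_bigr => i _; rewrite psum_nat.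
Qed.

(** The functional is the derivative of S at 0, so it inherits the linearity of S. *)
Lemma toddZ a p : todd (a *: p) = a * todd p.
Proof. by rewrite -!deriv_psum_at0 psumZ derivZ hornerZ. Qed.

Lemma todd_sum I (r : seq I) (Q : pred I) (F : I -> {poly K}) :
  todd (\sum_(i <- r | Q i) F i) = \sum_(i <- r | Q i) todd (F i).
Proof.
rewrite -deriv_psum_at0 psum_sum raddf_sum horner_sum.
by apply: eq_bigr => i _; rewrite deriv_psum_at0.
Qed.

(* The two sides have the same derivative, as the Todd operator commutes with D. *)
Lemma deriv_psumE p : (psum p)^`() = psum p^`() + (todd p)%:P.
Proof.
apply: (deriv_at0_inj char0).
  by rewrite derivD derivC addr0 !deriv_psum deriv_todd_op.
by rewrite hornerD hornerC psum_at0 add0r deriv_psum_at0.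
Qed.

Lemma poly_binom_nat (k n : nat) : (poly_binom K k).[n%:R] = 'C(n, k)%:R.
Proof.
rewrite /poly_binom hornerZ horner_prod.
have -> : \prod_(i < k) ('X - i%:R%:P).[n%:R] = (n ^_ k)%:R :> K.
  elim: k => [|k IHk]; first by rewrite big_ord0.
  rewrite big_ord_recr /= IHk ffactnSr natrM hornerXsubC.
  have [le_kn|lt_nk] := leqP k n; first by rewrite natrB.
  by rewrite ffact_small // !mul0r.
by rewrite -bin_ffact natrM mulrCA mulVf ?mulr1 ?char0_fact_neq0.
Qed.

(** Pascal's rule: the forward difference of the binomial polynomial of degree k + 1 is that of
    degree k. *)
Lemma psum_poly_binom k : psum (poly_binom K k) = poly_binom K k.+1.
Proof.
apply: eq_poly_nat => n; rewrite psum_nat poly_binom_nat.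
under eq_bigr => m _ do rewrite poly_binom_nat.
elim: n => [|n IHn]; first by rewrite big_ord0.
by rewrite big_ord_recr /= IHn binS natrD.
Qed.

Lemma todd_poly_binom k : todd (poly_binom K k) = (-1) ^+ k / k.+1%:R.
Proof.
rewrite -deriv_psum_at0 psum_poly_binom horner_coef0 coef_deriv mulr1n coefZ.
(* Splitting off the factor X turns the linear coefficient into the value at 0 of the remaining
   product. *)
rewrite big_ord_recl /= subr0 coefXM /= -horner_coef0 horner_prod.
have -> : \prod_(i < k) ('X - (bump 0 i)%:R%:P).[0] = (-1) ^+ k * k`!%:R :> K.
  elim: k => [|k IHk]; first by rewrite big_ord0 mul1r.
  rewrite big_ord_recr /= IHk hornerXsubC sub0r factS natrM exprSr mulrN /bump add1n.
  by rewrite -!mulrA mulN1r !mulrN [k.+1%:R * _]mulrC.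
rewrite factS natrM invfM mulrC -!mulrA; congr (_ * _).
by rewrite mulrCA mulfV ?mulr1 ?char0_fact_neq0.
Qed.

End PolynomialSums.

(** * Vertex order and polynomials of a rooted tree *)

Section TreeOrder.

Variables (V : finType) (T : rtree V).
Local Notation r := (troot T).
Local Notation p := (parent T).
Local Notation desc := (descendant T).

Lemma parent_root : p r = r.
Proof. by have /andP[/eqP pr _] := valP T; apply: pr. Qed.

Lemma desc_root v : desc v r.
Proof. by have /andP[_ /forallP] := valP T; apply. Qed.

Lemma desc_refl v : desc v v.
Proof. exact: connect0. Qed.

Lemma desc_trans u v w : desc u v -> desc v w -> desc u w.
Proof. exact: connect_trans. Qed.

Lemma desc_parent v : desc v (p v).
Proof. exact: fconnect1. Qed.

Definition depth v := findex p v r.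

Lemma depth_root : depth r = 0.
Proof. exact: findex0. Qed.

Lemma depth_parent v : v != r -> depth v = (depth (p v)).+1.
Proof. by rewrite eq_sym; apply: fconnect_findex; apply: desc_root. Qed.

Lemma depth_lt_card v : (depth v < #|V|)%N.
Proof.
apply: leq_trans (findex_max (desc_root v)) _; exact: max_card.
Qed.

Lemma root_ind (Q : V -> Prop) :
  Q r -> (forall v, v != r -> Q (p v) -> Q v) -> forall v, Q v.
Proof.
move=> Qr Qp v; have [m] := ubnP (depth v); elim: m v => // m IHm v.
rewrite ltnS; have [->//|Nv] := eqVneq v r.
by rewrite (depth_parent Nv) => lt_m; apply/Qp/IHm.
Qed.

(** The first conjunct excludes the loop at the root, which is its own parent by convention. *)
Definition child u v := (u != r) && (p u == v).

(** Induction from the leaves towards the root: depths stay below [#|V|], so [#|V| - depth v]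
    decreases at each child. *)
Lemma leaf_ind (Q : V -> Prop) :
  (forall v, (forall u, child u v -> Q u) -> Q v) -> forall v, Q v.
Proof.
move=> Qc v; have [m] := ubnP (#|V| - depth v); elim: m v => // m IHm v.
rewrite ltnS => le_m; apply: Qc => u /andP[Nu /eqP pu].
apply: IHm; apply: leq_trans le_m; apply: ltn_sub2l; first exact: depth_lt_card.
by rewrite (depth_parent Nu) pu.
Qed.

Lemma desc_root_eq v : desc r v = (v == r).
Proof.
apply/idP/eqP => [/iter_findex <-|->]; last exact: desc_refl.
by elim: (findex _ _ _) => //= k ->; apply: parent_root.
Qed.

Lemma desc_step x v : desc x v = (x == v) || (x != r) && desc (p x) v.
Proof.
have [->|Nxv] := eqVneq x v; first exact: desc_refl.
have [Ex|_] := eqVneq x r; first by rewrite Ex desc_root_eq eq_sym -Ex (negbTE Nxv).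
apply/idP/idP => [xv|]; last exact/desc_trans/desc_parent.
have := iter_findex xv; rewrite fconnect_findex // 1?eq_sym // iterSr => <-.
exact: fconnect_iter.
Qed.

Lemma desc_iter x v : desc x v ->
  (depth v <= depth x)%N /\ v = iter (depth x - depth v) p x.
Proof.
elim/root_ind: x => [|x Nx IHx].
  by rewrite desc_root_eq => /eqP ->; rewrite subnn.
rewrite desc_step; have [->|/= _] := eqVneq x v; first by rewrite subnn.
rewrite Nx => /IHx[le_v Ev]; rewrite (depth_parent Nx).
by rewrite subSn // iterSr -Ev; split=> //; apply: leqW.
Qed.

(** The ancestors of [x] are the iterated parents of [x], a chain on which depth determines the
    vertex. *)
Lemma desc_depth_inj x u v :
  desc x u -> desc x v -> depth u = depth v -> u = v.
Proof. by move=> /desc_iter[_ Eu] /desc_iter[_ Ev] E; rewrite Eu Ev E. Qed.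

Lemma desc_anti u v : desc u v -> desc v u -> u = v.
Proof.
move=> uv vu; apply: (desc_depth_inj (desc_refl u) uv).
by apply/eqP; rewrite eqn_leq; have [-> _] := desc_iter uv; have [-> _] := desc_iter vu.
Qed.

Lemma depth_child u v : child u v -> depth u = (depth v).+1.
Proof. by case/andP => /depth_parent -> /eqP ->. Qed.

Lemma desc_child u v : child u v -> desc u v.
Proof. by case/andP => _ /eqP <-; apply: desc_parent. Qed.

Lemma child_neq u v : child u v -> u != v.
Proof.
by move=> uv; apply: contra_eqN (depth_child uv) => /eqP ->; rewrite neq_ltn ltnSn.
Qed.

Lemma desc_parentN u v : child u v -> ~~ desc v u.
Proof.
move=> uv; apply/negP => vu; have := child_neq uv.
by rewrite (desc_anti (desc_child uv) vu) eqxx.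
Qed.

Lemma child_desc_inj x u u' v :
  child u v -> child u' v -> desc x u -> desc x u' -> u = u'.
Proof.
move=> uv u'v xu xu'; apply: (desc_depth_inj xu xu').
by rewrite (depth_child uv) (depth_child u'v).
Qed.

(** Names the branch of [v] containing [x] by its top vertex; the default [v] is the value when [x]
    is not strictly below [v]. *)
Definition branch v x := odflt v [pick u | child u v && desc x u].

Lemma branchP v x : desc x v -> x != v -> child (branch v x) v && desc x (branch v x).
Proof.
move=> xv Nxv; rewrite /branch; case: pickP => [//|N]; case/negP: Nxv.
elim/root_ind: x xv N => [|x Nx IHx]; first by rewrite desc_root_eq eq_sym.
rewrite desc_step; case: eqVneq => //= Nxv; rewrite Nx /= => pxv N.
have [E|Npx] := eqVneq (p x) v; first by have := N x; rewrite /child Nx E eqxx desc_refl.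
have /eqP := Npx; case; apply/eqP/IHx => // u; apply: contraFF (N u) => /andP[-> /=].
exact/desc_trans/desc_parent.
Qed.

Lemma branch_eq u v x : child u v -> desc x u -> branch v x = u.
Proof.
move=> uv xu; have xv := desc_trans xu (desc_child uv).
have Nxv : x != v by apply: contraNneq (desc_parentN uv) => <-.
by have /andP[bv xb] := branchP xv Nxv; apply: (child_desc_inj bv uv xb xu).
Qed.

Lemma decreasingP (d : V -> nat) :
  reflect (forall x, x != r -> (d x < d (p x))%N) (decreasing T d).
Proof.
apply: (iffP idP) => [/forallP dd x Nx|dd].
  move/forallP/(_ x): (dd (p x)); rewrite desc_parent andbT => /implyP; apply.
  by apply: contra_eqN (depth_parent Nx) => /eqP <-; rewrite neq_ltn ltnSn.
apply/forallP => v; apply/forallP => x; apply/implyP => /andP[+ xv].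
elim/root_ind: x xv => [|x Nx IHx].
  by rewrite desc_root_eq => /eqP ->; rewrite eqxx.
rewrite desc_step; case: eqVneq => //= Nxv; rewrite Nx /= => pxv _.
apply: leq_trans (dd x Nx) _; case: (eqVneq (p x) v) => [->//|N].
by rewrite ltnW // IHx.
Qed.

End TreeOrder.

(** * The polynomial of a rooted tree and its derivative *)

Section TreePolynomial.

Variable K : fieldType.

Section Def.
Variables (V : finType) (T : rtree V).

(** [k] is fuel, as a parent map offers no structural recursion. Discarding the children outside [A]
    lets one definition serve both the tree and the components left by cutting an edge. *)
Fixpoint gpoly_rec k (A : pred V) v : {poly K} :=
  if k is k'.+1 then \prod_(u | child T u v && A u) psum (gpoly_rec k' A u) else 1.

Definition gpoly (A : pred V) (v : V) : {poly K} := gpoly_rec (#|V| - depth T v) A v.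

Definition tpoly : {poly K} := gpoly predT (troot T).

(** The fuel [#|V| - depth T v] is positive and drops by exactly one at a child, so it never runs
    out. *)
Lemma gpolyE A v : gpoly A v = \prod_(u | child T u v && A u) psum (gpoly A u).
Proof.
rewrite /gpoly; have := depth_lt_card T v; rewrite -subn_gt0.
case E: (#|V| - depth T v)%N => [//|k] _ /=.
apply: eq_bigr => u /andP[/depth_child -> _].
by rewrite subnS E.
Qed.

Lemma eq_gpoly (A B : pred V) v :
  (forall x, descendant T x v -> x != v -> A x = B x) -> gpoly A v = gpoly B v.
Proof.
elim/(@leaf_ind _ T): v => v IHv AB; rewrite !gpolyE.
apply: eq_big => [u|u /andP[uv _]].
  by case uv: (child T u v) => //=; apply: AB; [exact: desc_child | exact: child_neq uv].
congr psum; apply: IHv => // x xu Nxu.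
have xv := desc_trans xu (desc_child uv); apply: AB => //.
by apply: contraNneq (desc_parentN uv) => <-.
Qed.

End Def.

(** Covers two uses: isomorphisms, with [A] everything, and the inclusion of a subtree with vertex
    set [A]. *)
Lemma gpoly_embed (V W : finType) (T : rtree V) (T' : rtree W) (A : pred W)
    (f : V -> W) : injective f ->
    (forall u v, child T u v -> child T' (f u) (f v) && A (f u)) ->
    (forall w v, child T' w (f v) -> A w -> exists2 u, child T u v & w = f u) ->
  forall v, gpoly T predT v = gpoly T' A (f v).
Proof.
move=> fI fc cf; elim/(@leaf_ind _ T) => v IHv; rewrite !gpolyE.
pose g w := odflt v [pick u | f u == w].
have gK u : g (f u) = u.
  by rewrite /g; case: pickP => [u' /eqP/fI //|/(_ u)]; rewrite eqxx.
rewrite (reindex_onto f g) /=; last first.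
  by move=> w /andP[wv Aw]; have [u _ ->] := cf _ _ wv Aw; rewrite gK.
apply: eq_big => [u|u /andP[uv _]]; last by rewrite IHv.
rewrite gK eqxx !andbT; apply/idP/andP => [/fc/andP //|[c1 c2]].
by have [u' cu' /fI ->] := cf _ _ c1 c2.
Qed.

Lemma tpoly_iso (V W : finType) (T : rtree V) (T' : rtree W) :
  isomorphic T T' -> tpoly T = tpoly T'.
Proof.
case/existsP => f /and4P[/injectiveP fI /forallP fS /eqP fr /forallP fp].
rewrite /tpoly -fr; apply: gpoly_embed => // [u v|w v].
  rewrite andbT => /andP[Nu /eqP <-]; rewrite /child -fr (inj_eq fI) Nu /=.
  by rewrite (eqP (fp u)).
have /codomP[u ->] := fS w; rewrite /child -fr (inj_eq fI) -(eqP (fp u)) (inj_eq fI).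
by move=> uv _; exists u.
Qed.

Hypothesis char0 : [pchar K] =i pred0.

Lemma deriv_prod (I : finType) (Q : pred I) (F : I -> {poly K}) :
  (\prod_(i | Q i) F i)^`() =
  \sum_(i | Q i) (F i)^`() * \prod_(j | Q j && (j != i)) F j.
Proof.
have [m] := ubnP #|Q|; elim: m Q => // m IHm Q; rewrite ltnS => leQ.
case: (pickP Q) => [i Qi|Q0]; last by rewrite !big_pred0 // derivC.
rewrite (bigD1 i) //= derivM [RHS](bigD1 i) //=; congr (_ + _).
rewrite IHm; last first.
  rewrite (cardD1 i) unfold_in Qi in leQ; apply: leq_trans leQ.
  by rewrite ltnS; apply/eq_leq/eq_card => j; rewrite !inE andbC.
rewrite mulr_sumr; apply: eq_bigr => j /andP[Qj Nji].
rewrite mulrCA; congr (_ * _); rewrite [RHS](bigD1 i) /=; last by rewrite Qi eq_sym.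
by congr (_ * _); apply: eq_bigl => k; rewrite andbAC.
Qed.

(* In the branch at a child u of v, (psum p)' = psum p' + todd p separates the *)
(* edge (u, v), which gives the term w = u, from the edges below u.            *)
Lemma deriv_gpoly (V : finType) (T : rtree V) v :
  (gpoly T predT v)^`() =
  \sum_(w | descendant T w v && (w != v))
     todd (gpoly T predT w) *: gpoly T (fun x => ~~ descendant T x w) v.
Proof.
elim/(@leaf_ind _ T): v => v IHv; rewrite {1}gpolyE deriv_prod.
(* The strict descendants [w] of [v] are grouped by the child [u] whose branch contains them. *)
rewrite [RHS](partition_big (branch T v) (fun u => child T u v)) /=; last first.
  by move=> w /andP[wv Nwv]; have /andP[] := branchP wv Nwv.
apply: eq_big => [u|u]; rewrite andbT // => uv.
rewrite [RHS](eq_bigl (fun w => descendant T w u)); last first.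
  move=> w; apply/idP/idP => [/andP[/andP[wv Nwv] /eqP <-]|wu].
    by have /andP[] := branchP wv Nwv.
  rewrite (branch_eq uv wu) eqxx (desc_trans wu (desc_child uv)) /= andbT.
  by apply: contraNneq (desc_parentN uv) => <-.
(* Removing what lies below [w], itself below [u], leaves the branches at the other children of [v]
   intact. *)
have rest w : descendant T w u ->
  \prod_(j | (child T j v && true) && (j != u)) psum (gpoly T predT j) =
  \prod_(j | (child T j v && ~~ descendant T j w) && (j != u))
     psum (gpoly T (fun x => ~~ descendant T x w) j).
  move=> wu; apply: eq_big => [j|j /andP[/andP[jv _] Nju]].
    case jv: (child T j v) => //=; case: (eqVneq j u) => [_|Nju]; rewrite ?andbF //=.
    rewrite andbT; apply/esym/negP => /desc_trans/(_ wu) ju; case/eqP: Nju.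
    exact: child_desc_inj jv uv (desc_refl _ _) ju.
  congr psum; apply: eq_gpoly => x xj _; apply/esym/negP => /desc_trans/(_ wu) xu.
  by case/eqP: Nju; apply: child_desc_inj jv uv xj xu.
rewrite [RHS](bigD1 u) ?desc_refl //= (deriv_psumE char0) IHv // psum_sum // mulrDl [LHS]addrC.
congr (_ + _).
  rewrite [gpoly _ _ v]gpolyE (rest u) ?desc_refl // mul_polyC; congr (_ *: _).
  apply: eq_bigl => j; have [->|_] := eqVneq j u; first by rewrite desc_refl !andbF.
  by rewrite andbT.
rewrite mulr_suml; apply: eq_bigr => w /andP[wu Nwu].
rewrite psumZ // -scalerAl; congr (_ *: _).
rewrite [RHS]gpolyE [RHS](bigD1 u) /=; last first.
  by rewrite uv /=; apply: contra Nwu => uw; rewrite (desc_anti wu uw).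
by rewrite (rest w wu).
Qed.

(** Each factor [psum _] vanishes at 0, so only an empty product survives. *)
Lemma gpoly_at0 (V : finType) (T : rtree V) A v :
  (gpoly T A v).[0] = [forall u, ~~ (child T u v && A u)]%:R.
Proof.
rewrite gpolyE horner_prod; case: forallP => [N|/forallP].
  by rewrite big_pred0 // => u; rewrite (negbTE (N u)).
rewrite negb_forall => /existsP[u]; rewrite negbK => uv.
by rewrite (bigD1 u) //= psum_at0 mul0r.
Qed.

End TreePolynomial.

(** * Isomorphisms and grafting *)

Section Isomorphisms.

Definition isos (V W : finType) (T : rtree V) (T' : rtree W) : {set {ffun V -> W}} :=
  [set f | is_iso T T' f].

Lemma isosP (V W : finType) (T : rtree V) (T' : rtree W) (f : {ffun V -> W}) :
  reflect [/\ injective f, (forall w, exists v, w = f v), f (troot T) = troot T'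
             & forall v, f (parent T v) = parent T' (f v)]
          (f \in isos T T').
Proof.
rewrite inE; apply: (iffP and4P) => -[].
  move=> /injectiveP fI /forallP fS /eqP fr /forallP fp; split=> // [w|v].
    by have /codomP[v ->] := fS w; exists v.
  exact/eqP.
move=> fI fS fr fp; split; [exact/injectiveP| |exact/eqP|].
  by apply/forallP => w; apply/codomP.
by apply/forallP => v; apply/eqP.
Qed.

Lemma isomorphicP (V W : finType) (T : rtree V) (T' : rtree W) :
  reflect (exists f, f \in isos T T') (isomorphic T T').
Proof. by apply: (iffP existsP) => -[f fT]; exists f; rewrite inE in fT *. Qed.

Lemma leq_card_isos (V1 V2 V3 V4 : finType) (T1 : rtree V1) (T2 : rtree V2)
    (T3 : rtree V3) (T4 : rtree V4) :
  isomorphic T1 T2 -> isomorphic T3 T4 -> (#|isos T2 T3| <= #|isos T1 T4|)%N.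
Proof.
move=> /isomorphicP[f /isosP[fI fS fr fp]] /isomorphicP[g /isosP[gI gS gr gp]].
pose F (h : {ffun V2 -> V3}) := [ffun v => g (h (f v))].
have FI : injective F.
  move=> h h' /ffunP E; apply/ffunP => v; have [u ->] := fS v.
  by have := E u; rewrite !ffunE => /gI.
rewrite -(card_imset _ FI); apply/subset_leq_card/subsetP => _ /imsetP[h + ->].
move=> /isosP[hI hS hr hp]; apply/isosP; split=> [x y|w||v].
- by rewrite !ffunE => /gI/hI/fI.
- have [y ->] := gS w; have [z ->] := hS y; have [x ->] := fS z.
  by exists x; rewrite ffunE.
- by rewrite ffunE fr hr.
- by rewrite !ffunE fp hp gp.
Qed.

Lemma card_isos (V1 V2 V3 V4 : finType) (T1 : rtree V1) (T2 : rtree V2)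
    (T3 : rtree V3) (T4 : rtree V4) :
  isomorphic T1 T2 -> isomorphic T3 T4 -> #|isos T2 T3| = #|isos T1 T4|.
Proof.
move=> T12 T34; apply/eqP; rewrite eqn_leq !leq_card_isos //; exact: isomorphic_sym.
Qed.

(** The isomorphisms are either absent or a torsor under the automorphism group. This brings in the
    factors |Aut|. *)
Lemma card_isos_source (V W : finType) (T : rtree V) (T' : rtree W) :
  #|isos T T'| = (isomorphic T T' * #|tree_aut T|)%N.
Proof.
have [TT'|/isomorphicP N] := boolP (isomorphic T T').
  by rewrite mul1n; apply: card_isos (isomorphic_refl T) (isomorphic_sym TT').
by apply: eq_card0 => f; apply/negP => fT; case: N; exists f.
Qed.

Lemma card_aut_iso (V W : finType) (T : rtree V) (T' : rtree W) :
  isomorphic T T' -> #|tree_aut T| = #|tree_aut T'|.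
Proof. by move=> TT'; apply: card_isos (isomorphic_sym TT') TT'. Qed.

Lemma card_isos_target (V W : finType) (T : rtree V) (T' : rtree W) :
  #|isos T T'| = (isomorphic T T' * #|tree_aut T'|)%N.
Proof.
by rewrite card_isos_source; case TT': (isomorphic T T'); rewrite ?(card_aut_iso TT').
Qed.

Lemma card_aut_gt0 (V : finType) (T : rtree V) : (0 < #|tree_aut T|)%N.
Proof.
by have /isomorphicP[f fT] := isomorphic_refl T; apply/card_gt0P; exists f.
Qed.

Lemma isomorphic_card (V W : finType) (T : rtree V) (T' : rtree W) :
  isomorphic T T' -> #|V| = #|W|.
Proof.
case/isomorphicP => f /isosP[fI fS _ _]; rewrite -(card_codom fI).
by apply: eq_card => w; have [v ->] := fS w; rewrite codom_f.
Qed.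

Lemma transport_subproof (V W : finType) (T : rtree V) (f : V -> W) (g : W -> V) :
  cancel f g -> cancel g f ->
  is_rtree (f (troot T), [ffun w => f (parent T (g w))]).
Proof.
move=> fK gK; rewrite /is_rtree /= ffunE fK parent_root eqxx /=; apply/forallP => w.
rewrite -(gK w); elim/(@root_ind _ T): (g w) => [|v _ IHv]; first exact: connect0.
apply: connect_trans IHv; have := fconnect1 [ffun w => f (parent T (g w))] (f v).
by rewrite ffunE fK.
Qed.

(** Subtrees live on sigma types, whereas isomorphism classes are made of trees on ordinals;
    numbering the vertices bridges the two. *)
Lemma ordinal_representative (V : finType) (T : rtree V) :
  exists T' : rtree 'I_#|V|, isomorphic T' T.
Proof.
exists (RTree (transport_subproof T enum_rankK enum_valK)).
apply/isomorphic_sym/isomorphicP; exists [ffun v => enum_rank v]; apply/isosP.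
split=> [x y|w||v].
- by rewrite !ffunE => /enum_rank_inj.
- by exists (enum_val w); rewrite ffunE enum_valK.
- by rewrite ffunE.
- by rewrite /parent /= !ffunE enum_rankK.
Qed.

End Isomorphisms.

(** * Cutting a tree at an edge, and regrafting *)

Section Subtrees.

Variables (V : finType) (T : rtree V).
Local Notation r := (troot T).
Local Notation p := (parent T).
Local Notation desc := (descendant T).

Section Def.

Variables (A : pred V) (a : V) (Aa : A a).
Hypothesis Ap : forall x, A x -> x != a -> A (p x) && desc x a.

(** Parents are inherited from [T], and [a] becomes the root. The default of [insubd] is not
    reached: [Ap] keeps the parent of any [x] in [A] other than [a] inside [A]. *)
Definition subtree_parent : {ffun {x | A x} -> {x | A x}} :=
  [ffun x => if val x == a then x else insubd x (p (val x))].

Lemma val_subtree_parent x :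
  val (subtree_parent x) = if val x == a then a else p (val x).
Proof.
rewrite ffunE; case: eqVneq => // Nx; rewrite insubdK //.
by case/andP: (Ap (valP x) Nx).
Qed.

Lemma subtree_desc x : A x -> desc x a.
Proof.
by have [->|Nx /Ap/(_ Nx)/andP[]//] := eqVneq x a; rewrite desc_refl.
Qed.

Lemma subtree_subproof : is_rtree (exist A a Aa, subtree_parent).
Proof.
rewrite /is_rtree /= -val_eqE val_subtree_parent /= eqxx eqxx; apply/forallP => x.
elim/(@root_ind _ T): (val x) {-2}x (erefl (val x)) => {x} [|y Ny IHy] x Ex.
  have Er : r = a by apply/esym/eqP; rewrite -desc_root_eq -Ex; apply/subtree_desc/valP.
  by rewrite (_ : x = exist A a Aa) ?connect0 //; apply/val_inj; rewrite /= Ex.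
have [Ea|Na] := eqVneq (val x) a.
  by rewrite (_ : x = exist A a Aa) ?connect0 //; apply/val_inj.
apply: connect_trans (fconnect1 _ _) (IHy _ _).
by rewrite val_subtree_parent (negbTE Na) Ex.
Qed.

Definition subtree : rtree {x | A x} := RTree subtree_subproof.

Lemma tpoly_subtree (K : fieldType) : tpoly K subtree = gpoly K T A a.
Proof.
rewrite /tpoly; apply: (@gpoly_embed K _ _ subtree T A val) => [|u v|w v].
- exact: val_inj.
- case/andP; rewrite -val_eqE /= => Nu /eqP <-.
  rewrite val_subtree_parent (negbTE Nu) /child eqxx andbT (valP u) andbT.
  apply: contraNneq Nu => Eu; rewrite Eu eq_sym -desc_root_eq -Eu.
  exact/subtree_desc/valP.
- move=> wv Aw; exists (exist A w Aw) => //.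
  have Nw : w != a.
    by apply: contraTneq (subtree_desc (valP v)) => <-; apply: desc_parentN.
  rewrite /child -!val_eqE /= val_subtree_parent /= (negbTE Nw) /=.
  by case/andP: wv.
Qed.

End Def.

Lemma branch_subproof w x : desc x w -> x != w -> desc (p x) w && desc x w.
Proof.
by move=> xw Nx; rewrite xw; move: xw; rewrite desc_step (negbTE Nx) /= => /andP[_ ->].
Qed.

(** With [trunk_tree] below, the two components left when the edge from [w] to its parent is cut. *)
Definition branch_tree w := @subtree (fun x => desc x w) w (desc_refl T w) (@branch_subproof w).

(* The disjunct [x == r] matters only when w is the root: it makes trunk_tree *)
(* total, although that value is never used.                                  *)
Definition off_branch w x := ~~ desc x w || (x == r).

Lemma off_branch_root w : off_branch w r.
Proof. by rewrite /off_branch eqxx orbT. Qed.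

Lemma off_branchE w x : w != r -> off_branch w x = ~~ desc x w.
Proof.
rewrite /off_branch => Nw; have [->|_] := eqVneq x r; last by rewrite orbF.
by rewrite desc_root_eq Nw.
Qed.

Lemma trunk_subproof w x : off_branch w x -> x != r -> off_branch w (p x) && desc x r.
Proof.
rewrite desc_root andbT => + Nx; rewrite /off_branch (negbTE Nx) orbF => xw.
by rewrite (contra _ xw) //; apply/desc_trans/desc_parent.
Qed.

Definition trunk_tree w := @subtree (off_branch w) r (off_branch_root w) (@trunk_subproof w).

Lemma tpoly_branch (K : fieldType) w : tpoly K (branch_tree w) = gpoly K T predT w.
Proof. by rewrite tpoly_subtree; apply: eq_gpoly. Qed.

Lemma tpoly_trunk (K : fieldType) w : w != r ->
  tpoly K (trunk_tree w) = gpoly K T (fun x => ~~ desc x w) r.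
Proof. by move=> Nw; rewrite tpoly_subtree; apply: eq_gpoly => x _ _; apply: off_branchE. Qed.

Lemma deriv_tpoly (K : fieldType) : [pchar K] =i pred0 ->
  (tpoly K T)^`() =
  \sum_(w | w != r) todd (tpoly K (branch_tree w)) *: tpoly K (trunk_tree w).
Proof.
move=> char0; rewrite /tpoly deriv_gpoly //; apply: eq_big => [w|w /andP[_ Nw]].
  by rewrite desc_root.
by rewrite -tpoly_branch -tpoly_trunk.
Qed.

Section GraftIsos.

Variables (V1 V2 : finType) (T1 : rtree V1) (T2 : rtree V2).

Definition glue w (fg : {ffun V1 -> {x | desc x w}} * {ffun V2 -> {x | off_branch w x}})
    : V2 * {ffun V1 + V2 -> V} :=
  (odflt (troot T2) [pick v | val (fg.2 v) == p w],
   [ffun x => match x with inl u => val (fg.1 u) | inr u => val (fg.2 u) end]).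

Lemma glue_inj w : injective (@glue w).
Proof.
move=> [f g] [f' g'] [_ /ffunP E]; congr (_, _); apply/ffunP => u; apply/val_inj.
  by have := E (inl u); rewrite !ffunE.
by have := E (inr u); rewrite !ffunE.
Qed.

Lemma graft_parentl v u : u != troot T1 ->
  parent (graft T1 v T2) (inl u) = inl (parent T1 u).
Proof. by rewrite ffunE => /negbTE ->. Qed.

Lemma graft_parent_root v : parent (graft T1 v T2) (inl (troot T1)) = inr v.
Proof. by rewrite ffunE eqxx. Qed.

Lemma graft_parentr v u : parent (graft T1 v T2) (inr u) = inr (parent T2 u).
Proof. by rewrite ffunE. Qed.

(** An isomorphism sending the root of T1 to [w] sends the new edge to the edge above [w]. It
    therefore restricts to isomorphisms of T1 and T2 onto the two components, and these determine it
    together with [v]. *)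
Lemma glue_isos w : w != r ->
  [set vh : V2 * {ffun V1 + V2 -> V} |
     (vh.2 \in isos (graft T1 vh.1 T2) T) && (vh.2 (inl (troot T1)) == w)] =
  @glue w @: setX (isos T1 (branch_tree w)) (isos T2 (trunk_tree w)).
Proof.
move=> Nw; apply/setP => -[v h]; apply/idP/imsetP.
  rewrite inE /= => /andP[/isosP[hI hS hr hp] /eqP hw].
  have hl u : desc (h (inl u)) w.
    elim/(@root_ind _ T1): u => [|u Nu IHu]; first by rewrite hw desc_refl.
    by apply: desc_trans IHu; rewrite -(graft_parentl v Nu) hp desc_parent.
  (* A vertex of T2 climbs inside T2 up to its root, which goes to [r]; on the way it never meets
     [w], the image of a vertex of T1. *)
  have hNr u : ~~ desc (h (inr u)) w.
    elim/(@root_ind _ T2): u => [|u Nu IHu].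
      by have -> := hr; rewrite desc_root_eq.
    rewrite desc_step -{1}hw (inj_eq hI) /= -hp graft_parentr.
    by rewrite (negbTE IHu) andbF.
  have hr' u : off_branch w (h (inr u)) by rewrite off_branchE.
  pose f := [ffun u => exist (fun x => desc x w) (h (inl u)) (hl u)].
  pose g := [ffun u => exist (off_branch w) (h (inr u)) (hr' u)].
  exists (f, g).
    apply/setXP; split; apply/isosP; split=> [x y|x||u].
    - by rewrite !ffunE => -[/hI[]].
    - have [[u|u] Ex] := hS (val x).
        by exists u; apply/val_inj; rewrite ffunE.
      by have := hNr u; rewrite -Ex (valP x).
    - by apply/val_inj; rewrite ffunE.
    - apply/val_inj; rewrite val_subtree_parent; last exact: branch_subproof.
      rewrite !ffunE /= -hw (inj_eq hI).
      have [->|Nu] := eqVneq u (troot T1); first by rewrite parent_root eqxx.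
      by rewrite -hp graft_parentl //; case: eqP => // -[] E; rewrite E eqxx in Nu.
    - by rewrite !ffunE => -[/hI[]].
    - have [[u|u] Ex] := hS (val x); last by exists u; apply/val_inj; rewrite ffunE.
      by have := valP x; rewrite off_branchE // Ex hl.
    - by apply/val_inj; rewrite ffunE.
    - apply/val_inj; rewrite val_subtree_parent; last exact: trunk_subproof.
      rewrite !ffunE /= -hr (inj_eq hI).
      case: eqP => [[->]|_]; first by rewrite parent_root.
      by rewrite -hp graft_parentr.
  congr (_, _); last by apply/ffunP => -[u|u]; rewrite !ffunE.
  case: pickP => [u|/(_ v)] /=; rewrite !ffunE /= -hw -hp graft_parent_root.
    by move=> /eqP/hI[->].
  by rewrite eqxx.
case=> -[f g] /setXP[/isosP[fI fS fr fp] /isosP[gI gS gr gp]] [-> ->] {v h}.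
(* The parent of [w] is off the branch, hence in the image of [g], so the [pick] in [glue]
   succeeds. *)
have Npw : off_branch w (p w).
  by rewrite off_branchE // desc_parentN // /child Nw /=.
have [v Ev] := gS (exist (off_branch w) _ Npw).
rewrite inE /= ffunE fr /= eqxx andbT.
case: pickP => [v'|/(_ v)] /=; last by rewrite -Ev eqxx.
move=> /eqP {v Ev} Ev; apply/isosP.
have fgN u u' : val (f u) <> val (g u').
  by move=> E; have := valP (g u'); rewrite off_branchE // -E (valP (f u)).
split=> [[x|x] [y|y]|x||[u|u]].
- by rewrite !ffunE => /val_inj/fI ->.
- by rewrite !ffunE => /fgN.
- by rewrite !ffunE => /esym/fgN.
- by rewrite !ffunE => /val_inj/gI ->.
- have [xw|Nxw] := boolP (desc x w).
    by have [u Eu] := fS (exist (fun x => desc x w) _ xw); exists (inl u); rewrite ffunE -Eu.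
  have Ox : off_branch w x by rewrite off_branchE.
  by have [u Eu] := gS (exist (off_branch w) _ Ox); exists (inr u); rewrite ffunE -Eu.
- by rewrite ffunE /= gr.
- rewrite [in RHS]ffunE; have [->|Nu] := eqVneq u (troot T1).
    by rewrite graft_parent_root ffunE fr Ev.
  rewrite graft_parentl // ffunE.
  have := congr1 val (fp u); rewrite val_subtree_parent; last exact: branch_subproof.
  by move=> ->; case: eqP => // E; case/eqP: Nu; apply/fI/val_inj; rewrite fr.
- rewrite [in RHS]ffunE graft_parentr ffunE.
  have := congr1 val (gp u); rewrite val_subtree_parent; last exact: trunk_subproof.
  by move=> ->; case: eqP => // ->; rewrite parent_root.
Qed.

(** The pairs (v, isomorphism) are sorted by the image [w] of the root of T1, which differs from [r]
    because [r] is the image of the root of T2. *)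
Lemma sum_card_graft_isos :
  (\sum_v #|isos (graft T1 v T2) T| =
   \sum_(w | w != r) #|isos T1 (branch_tree w)| * #|isos T2 (trunk_tree w)|)%N.
Proof.
transitivity (\sum_(vh : V2 * {ffun V1 + V2 -> V}
                       | vh.2 \in isos (graft T1 vh.1 T2) T) 1)%N.
  under eq_bigr => v _ do rewrite -sum1_card.
  by rewrite pair_big_dep.
rewrite (partition_big (fun vh : V2 * {ffun V1 + V2 -> V} => vh.2 (inl (troot T1)))
           (fun w => w != r)) /=; last first.
  by move=> [v h] /isosP[/= hI _ <- _]; rewrite (inj_eq hI).
apply: eq_bigr => w Nw; rewrite -cardsX -(card_imset _ (@glue_inj w)) -glue_isos //.
by rewrite -sum1_card; apply: eq_bigl => vh; rewrite inE.
Qed.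

End GraftIsos.

End Subtrees.

(** * Counting decorations *)

Section DecorationCount.

Variables (V : finType) (T : rtree V).
Local Notation r := (troot T).
Local Notation p := (parent T).
Local Notation desc := (descendant T).

Section LocalDecorations.

Variable N : nat.

(* Decorations of the vertices below v, extended by 0 to the other vertices. *)
Definition decreasing_below v (d : {ffun V -> 'I_N.+1}) : bool :=
  [forall x, if desc x v then (x != v) ==> (d x < d (p x))%N else d x == ord0].

Lemma decreasing_belowP v (d : {ffun V -> 'I_N.+1}) :
  reflect ((forall x, desc x v -> x != v -> (d x < d (p x))%N) /\
           (forall x, ~~ desc x v -> d x = ord0))
          (decreasing_below v d).
Proof.
apply: (iffP forallP) => [dd|[d1 d2] x].
  by split=> x => [xv Nx|/negbTE xv]; have := dd x; rewrite xv ?Nx // => /eqP.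
case: ifPn => [xv|/d2->//]; apply/implyP; exact: d1.
Qed.

Definition decorations_below v i :=
  [set d : {ffun V -> 'I_N.+1} | decreasing_below v d & d v == i :> nat].

Definition decorations_below_lt v i :=
  [set d : {ffun V -> 'I_N.+1} | decreasing_below v d & (d v < i)%N].

Lemma card_decorations_below_lt v i :
  #|decorations_below_lt v i| = (\sum_(m < i) #|decorations_below v m|)%N.
Proof.
elim: i => [|i IHi].
  by rewrite big_ord0; apply: eq_card0 => d; rewrite inE ltn0 andbF.
rewrite big_ord_recr /= -IHi -cardsUI.
rewrite [X in (_ + X)%N](_ : _ = 0%N) ?addn0; last first.
  apply: eq_card0 => d; rewrite !inE; case: (decreasing_below v d) => //=.
  by case: ltngtP.
by apply: eq_card => d; rewrite !inE -andb_orr ltnS leq_eqVlt orbC.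
Qed.

(** Once [v] has value [i], the branches at its children are decorated independently, the only
    constraint from [v] being that their top values are below [i]. *)
Lemma card_decorations_below v i : (i <= N)%N ->
  #|decorations_below v i| = (\prod_(u | child T u v) #|decorations_below_lt u i|)%N.
Proof.
move=> le_iN; pose z : {ffun V -> 'I_N.+1} := [ffun=> ord0].
(* A vertex that is not a child of [v] gets a singleton, hence a factor 1, so the product counts a
   family indexed by all of [V]. *)
pose F u := if child T u v then decorations_below_lt u i else [set z].
transitivity (\prod_u #|F u|)%N; last first.
  rewrite [RHS]big_mkcond; apply: eq_bigr => u _.
  by rewrite /F; case: ifP => // _; rewrite cards1.
have -> : (\prod_u #|F u|)%N = #|[set g : {ffun V -> {ffun V -> 'I_N.+1}} in family F]|.
  by rewrite cardsE card_family foldrE big_map big_enum.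
pose R (d : {ffun V -> 'I_N.+1}) : {ffun V -> {ffun V -> 'I_N.+1}} :=
  [ffun u => [ffun x => if child T u v && desc x u then d x else ord0]].
have RI : {in decorations_below v i &, injective R}.
  move=> d d'; rewrite !inE => /andP[/decreasing_belowP[_ d0] /eqP dv].
  move=> /andP[/decreasing_belowP[_ d'0] /eqP d'v] /ffunP E; apply/ffunP => x.
  have [->|Nx] := eqVneq x v; first by apply/val_inj; rewrite /= dv d'v.
  have [xv|Nxv] := boolP (desc x v); last by rewrite d0 // d'0.
  have /andP[bv xb] := branchP xv Nx.
  by have /ffunP/(_ x) := E (branch T v x); rewrite !ffunE bv xb.
rewrite -(card_in_imset RI); apply: eq_card => g; apply/imsetP/idP.
  case=> d + ->; rewrite !inE => /andP[/decreasing_belowP[dd d0] /eqP dv].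
  apply/familyP => u; rewrite ffunE /F; case: ifP => [uv|Nuv]; last first.
    by rewrite inE; apply/eqP/ffunP => x; rewrite !ffunE.
  rewrite inE; apply/andP; split.
    apply/decreasing_belowP; split=> x => [xu Nx|/negbTE xu]; last by rewrite ffunE xu.
    have xv := desc_trans xu (desc_child uv).
    have Nxv : x != v by apply: contraNneq (desc_parentN uv) => <-.
    move: (xu); rewrite desc_step (negbTE Nx) => /andP[_ pxu].
    by rewrite !ffunE xu pxu dd.
  rewrite ffunE desc_refl -dv /=; have := dd u (desc_child uv) (child_neq uv).
  by case/andP: uv => _ /eqP ->.
rewrite inE => /familyP Fg.
have gB u : child T u v ->
    [/\ (forall x, desc x u -> x != u -> (g u x < g u (p x))%N),
        (forall x, ~~ desc x u -> g u x = ord0) & (g u u < i)%N].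
  move=> uv; have := Fg u; rewrite /F uv inE => /andP[/decreasing_belowP[]].
  by split.
(* The inverse of [R]: each [x] strictly below [v] takes its value from the member of [g] indexed by
   its branch. The bound [i <= N] makes [inord i] equal to [i]. *)
pose d : {ffun V -> 'I_N.+1} := [ffun x =>
  if x == v then inord i else if desc x v then g (branch T v x) x else ord0].
have dB u x : child T u v -> desc x u -> d x = g u x.
  move=> uv xu; rewrite ffunE (desc_trans xu (desc_child uv)) (branch_eq uv xu).
  by case: eqVneq => // E; move: (desc_parentN uv); rewrite -E xu.
have dv : d v = i :> nat by rewrite ffunE eqxx inordK.
exists d.
  rewrite inE dv eqxx andbT; apply/decreasing_belowP; split=> x => [xv Nx|Nxv].
    have /andP[bv xb] := branchP xv Nx; rewrite (dB _ _ bv xb).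
    have [g1 g2 g3] := gB _ bv.
    have [Ex|Nxb] := eqVneq x (branch T v x).
      have -> : p x = v by rewrite Ex; case/andP: bv => _ /eqP.
      by rewrite dv -Ex in g3 *.
    move: (xb); rewrite desc_step (negbTE Nxb) => /andP[_ pxb].
    by rewrite (dB _ _ bv pxb) g1.
  rewrite ffunE (negbTE Nxv); case: eqP => // E.
  by rewrite E desc_refl in Nxv.
apply/ffunP => u; apply/ffunP => x; rewrite ffunE ffunE.
case uv: (child T u v) => /=; last first.
  by have := Fg u; rewrite /F uv inE => /eqP ->; rewrite ffunE.
case: ifPn => [xu|Nxu]; first by rewrite (dB u x).
by have [_ g0 _] := gB _ uv; rewrite g0.
Qed.

End LocalDecorations.

Variable K : fieldType.
Hypothesis char0 : [pchar K] =i pred0.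

(** Induction from the leaves: by [psum_nat], the factor at a child sums the counts over the top
    values m < i, as the branch decomposition requires. *)
Lemma gpoly_nat N v i : (i <= N)%N ->
  (gpoly K T predT v).[i%:R] = #|decorations_below N v i|%:R.
Proof.
elim/(@leaf_ind _ T): v i => v IHv i le_iN.
rewrite card_decorations_below // gpolyE horner_prod natr_prod.
apply: eq_big => [u|u /andP[uv _]]; first by rewrite andbT.
rewrite (psum_nat char0) card_decorations_below_lt natr_sum; apply: eq_bigr => m _.
by apply: IHv => //; apply: leq_trans le_iN; apply: ltnW.
Qed.

Lemma tpoly_nat i : (tpoly K T).[i%:R] = #|decorations T i|%:R.
Proof.
rewrite /tpoly (gpoly_nat r (leqnn i)); congr _%:R; apply: eq_card => d.
rewrite !inE; congr (_ && _); apply/decreasing_belowP/decreasingP => [[dd _] x Nx|dd].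
  exact/dd/Nx/desc_root.
by split=> x => [_|/negP[]]; [exact: dd | exact: desc_root].
Qed.

End DecorationCount.

(** * Complete decorations and the binomial expansion *)

Section CompleteDecorations.

Variables (V : finType) (T : rtree V).
Local Notation r := (troot T).
Local Notation p := (parent T).

(** The image contains the root value k, so being an initial segment means being all of ['I_k.+1]:
    completeness is surjectivity. *)
Lemma complete_decorationsP k (c : {ffun V -> 'I_k.+1}) :
  reflect [/\ forall x, x != r -> (c x < c (p x))%N, c r = ord_max
             & forall m, exists x, m = c x]
          (c \in complete_decorations T k).
Proof.
rewrite !inE; apply: (iffP idP).
  case/andP=> /andP[/decreasingP cd /eqP cr] /existsP[k' /forallP ck]; split=> //.
    exact: val_inj.
  move=> m; apply/codomP; rewrite (eqP (ck m)).
  have := ck (c r); rewrite codom_f eq_sym => /eqP; rewrite cr => /(leq_trans _) -> //.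
  by rewrite -ltnS.
case=> /decreasingP -> /= -> cS; rewrite eqxx /=; apply/existsP; exists ord_max.
by apply/forallP => m; have [x ->] := cS m; rewrite codom_f -ltnS ltn_ord.
Qed.

Lemma decoration_depth i (d : {ffun V -> 'I_i.+1}) v :
  d \in decorations T i -> (d v + depth T v <= i)%N.
Proof.
rewrite inE => /andP[/decreasingP dd /eqP dr].
elim/(@root_ind _ T): v => [|v Nv IHv]; first by rewrite dr depth_root addn0.
by rewrite depth_parent // addnS -addSn; apply: leq_trans IHv; rewrite leq_add2r dd.
Qed.

(** Values drop by at least one along each edge, which bounds the height by k; surjectivity onto k +
    1 values needs k + 1 vertices. *)
Lemma complete_decorations_bounds k :
  #|complete_decorations T k| != 0%N -> (tree_height T <= k < #|V|)%N.
Proof.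
rewrite -lt0n => /card_gt0P[c cT]; apply/andP; split.
  apply/bigmax_leqP => v _; apply: leq_trans (leq_addl (c v) _) _.
  by apply: decoration_depth; rewrite inE in cT; case/andP: cT.
have /complete_decorationsP[_ _ cS] := cT.
have <- : #|codom c| = k.+1.
  by rewrite -[RHS]card_ord; apply: eq_card => m; have [x ->] := cS m; rewrite codom_f.
exact: leq_image_card.
Qed.

Lemma increasing_enumeration i k (A : {set 'I_i.+1}) : #|A| = k.+1 ->
  exists2 e : 'I_k.+1 -> 'I_i.+1,
    (forall m m', (e m < e m')%N = (m < m')%N) & forall a, a \in A <-> exists m, a = e m.
Proof.
(* [rank a] counts the elements of [A] below [a]. On [A] it is an increasing bijection onto
   ['I_k.+1], and [e] is its inverse. *)
move=> cA; pose rank (a : 'I_i.+1) := #|[set b in A | (b < a)%N]|.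
have rank_mono (a b : 'I_i.+1) : a \in A -> (a < b)%N -> (rank a < rank b)%N.
  move=> Aa lt_ab; apply/proper_card/properP; split.
    apply/subsetP => c; rewrite !inE => /andP[-> /= lt_ca].
    exact: ltn_trans lt_ca lt_ab.
  by exists a; rewrite !inE ?Aa ?ltnn.
have rank_lt a : a \in A -> (rank a < k.+1)%N.
  move=> Aa; rewrite -cA; apply/proper_card/properP; split.
    by apply/subsetP => c; rewrite inE => /andP[].
  by exists a => //; rewrite inE ltnn andbF.
pose rk a : 'I_k.+1 := inord (rank a).
have rk_inj : {in A &, injective rk}.
  move=> a b Aa Ab /(congr1 val); rewrite /= !inordK ?rank_lt // => E.
  apply/val_inj; case: (ltngtP a b) => // [/(rank_mono _ _ Aa)|/(rank_mono _ _ Ab)];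
    by rewrite E ltnn.
have rk_surj m : exists2 a, a \in A & m = rk a.
  apply/imsetP; suff -> : rk @: A = setT by [].
  by apply/eqP; rewrite eqEcard subsetT cardsT card_ord card_in_imset // cA /=.
pose e m := odflt ord0 [pick a in A | rk a == m].
have eP m : e m \in A /\ rk (e m) = m.
  rewrite /e; case: pickP => [a /andP[Aa /eqP]|] //= N.
  by have [a Aa E] := rk_surj m; have := N a; rewrite Aa E eqxx.
have e_rank m : rank (e m) = m.
  by have [Ae E] := eP m; rewrite -[in RHS]E /= inordK ?rank_lt.
exists e => [m m'|a]; last first.
  split=> [Aa|[m ->]]; last by have [] := eP m.
  by exists (rk a); have [Ae E] := eP (rk a); apply: rk_inj.
have [[Am _] [Am' _]] := (eP m, eP m').
apply/idP/idP => [/(rank_mono _ _ Am)|]; first by rewrite !e_rank.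
apply: contraTT; rewrite -!leqNgt leq_eqVlt => /orP[/eqP/val_inj E|].
  by rewrite -(e_rank m) -(e_rank m') E.
by move=> /(rank_mono _ _ Am'); rewrite !e_rank; apply: ltnW.
Qed.

(** The bijection is composition with the increasing enumeration of [A], which preserves and
    reflects strict inequalities. *)
Lemma card_decorations_image i k (A : {set 'I_i.+1}) :
  ord_max \in A -> #|A| = k.+1 ->
  #|[set d in decorations T i | d @: setT == A]| = #|complete_decorations T k|.
Proof.
move=> Amax cA; have [e e_mono eA] := increasing_enumeration cA.
have eI : injective e.
  move=> m m' E; apply/val_inj; case: (ltngtP m m') => //;
    by rewrite -e_mono E ltnn.
(* As [A] contains the largest value, [e] sends top to top, so root values match. *)
have emax : e ord_max = ord_max.
  have [m Em] := (eA _).1 Amax; rewrite Em; congr e; apply/val_inj => /=.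
  have := leq_ord (e ord_max); rewrite -[X in (_ <= X)%N]/(val (@ord_max i)) Em.
  by rewrite leqNgt e_mono -leqNgt => le_km; apply/eqP; rewrite eqn_leq le_km leq_ord.
pose G (c : {ffun V -> 'I_k.+1}) := [ffun x => e (c x)].
have GI : injective G.
  by move=> c c' /ffunP E; apply/ffunP => x; have := E x; rewrite !ffunE => /eI.
rewrite -[RHS](card_imset _ GI); apply: eq_card => d; apply/idP/imsetP.
  rewrite !inE => /andP[/andP[/decreasingP dd /eqP dr] /eqP dA].
  have dE x : exists m, d x = e m by apply/eA; rewrite -dA imset_f.
  pose c := [ffun x => odflt ord0 [pick m | d x == e m]].
  have cE x : d x = e (c x).
    rewrite ffunE; case: pickP => [m /eqP //|N]; have [m Em] := dE x.
    by have := N m; rewrite Em eqxx.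
  exists c; last by apply/ffunP => x; rewrite ffunE.
  apply/complete_decorationsP; split=> [x Nx||m].
  - by rewrite -e_mono -!cE dd.
  - by apply: eI; rewrite -cE emax; apply: val_inj.
  - have : e m \in A by apply/eA; exists m.
    by rewrite -dA => /imsetP[x _]; rewrite cE => /eI ->; exists x.
case=> c /complete_decorationsP[cd cr cS] ->; rewrite !inE; apply/andP; split.
  apply/andP; split; last by rewrite ffunE cr emax.
  by apply/decreasingP => x Nx; rewrite !ffunE e_mono cd.
apply/eqP/setP => a; apply/imsetP/idP => [[x _ ->]|/eA[m ->]].
  by rewrite ffunE; apply/eA; exists (c x).
by have [x ->] := cS m; exists x; rewrite ?ffunE.
Qed.

(** Deleting the maximum leaves a k-subset of the i other elements. *)
Lemma card_sets_with_max i k :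
  #|[set A : {set 'I_i.+1} | (ord_max \in A) && (#|A| == k.+1)]| = 'C(i, k).
Proof.
have cC : #|[set~ (@ord_max i)]| = i by rewrite cardsC1 card_ord.
have sC (B : {set 'I_i.+1}) : (B \subset [set~ ord_max]) = (ord_max \notin B).
  by rewrite -disjoints_subset disjoint_sym disjoints1.
rewrite -[in RHS]cC -cards_draws.
have GI : {in [set B : {set 'I_i.+1} | B \subset [set~ ord_max] & #|B| == k] &,
           injective (fun B => ord_max |: B)}.
  move=> B B'; rewrite !inE !sC => /andP[NB _] /andP[NB' _] E.
  by rewrite -(setU1K NB) E setU1K.
rewrite -(card_in_imset GI); apply: eq_card => A; apply/idP/imsetP.
  rewrite inE => /andP[Am cA]; exists (A :\ ord_max); last by rewrite setD1K.
  by rewrite inE sC !inE eqxx /=; rewrite (cardsD1 ord_max) Am in cA.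
case=> B; rewrite inE sC => /andP[NB /eqP cB] ->.
by rewrite !inE eqxx cardsU1 NB cB add1n eqxx.
Qed.

(** Decorations are sorted by their image [A], which contains the root value [i], then the images by
    their size k + 1. *)
Lemma card_decorations i :
  #|decorations T i| = (\sum_(k < i.+1) #|complete_decorations T k| * 'C(i, k))%N.
Proof.
rewrite -sum1_card (partition_big (fun d : {ffun V -> 'I_i.+1} => d @: setT)
          (fun A => ord_max \in A)) /=; last first.
  move=> d; rewrite inE => /andP[_ /eqP dr]; apply/imsetP; exists r => //.
  exact/esym/val_inj.
have cA_gt0 (A : {set 'I_i.+1}) : ord_max \in A -> (0 < #|A|)%N.
  by move=> Am; apply/card_gt0P; exists ord_max.
have cA_le (A : {set 'I_i.+1}) : (#|A|.-1 < i.+1)%N.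
  by rewrite ltnS -subn1 leq_subLR add1n; have := max_card (mem A); rewrite card_ord.
rewrite (partition_big (fun A : {set 'I_i.+1} => inord #|A|.-1 : 'I_i.+1) predT) //=.
apply: eq_bigr => k _; rewrite mulnC -card_sets_with_max -sum_nat_const.
apply: eq_big => [A|A /andP[Am /eqP Ek]].
  rewrite inE; case Am: (ord_max \in A) => //=.
  by rewrite -val_eqE /= inordK // -(prednK (cA_gt0 A Am)) eqSS.
rewrite -(@card_decorations_image i k A) //; last first.
  by rewrite -Ek inordK // prednK // cA_gt0.
by rewrite -sum1_card; apply: eq_bigl => d; rewrite !inE.
Qed.

End CompleteDecorations.

(** * The differential equation *)

Lemma sum_nat_support (f : nat -> nat) a b N :
    (b <= N)%N -> (forall k, f k != 0%N -> (a <= k < b)%N) ->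
  (\sum_(a <= k < b) f k = \sum_(k < N) f k)%N.
Proof.
move=> le_bN f0; rewrite (big_nat_widen _ _ N) // (big_nat_widenl _ 0) //= big_mkord.
rewrite big_mkcond; apply: eq_bigr => k _.
by case: ifPn => //; apply: contraNeq; rewrite eq_sym => /f0/andP[-> ->].
Qed.

(** The ranges of this sum and of [card_decorations] differ by zero terms only: no complete
    decoration exists outside the bounds, and the binomial vanishes for k > i. *)
Lemma sum_complete_decorations (V : finType) (T : rtree V) i :
  (\sum_(tree_height T <= k < #|V|) #|complete_decorations T k| * 'C(i, k) =
   #|decorations T i|)%N.
Proof.
rewrite card_decorations.
pose f k := (#|complete_decorations T k| * 'C(i, k))%N.
rewrite (@sum_nat_support f _ _ (#|V| + i.+1)) ?leq_addr //; last first.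
  by move=> k; rewrite muln_eq0 negb_or => /andP[/complete_decorations_bounds].
rewrite -(@sum_nat_support f 0 i.+1) ?leq_addl ?big_mkord // => k.
by apply: contraNT; rewrite -leqNgt => lt_ik; rewrite /f bin_small ?muln0.
Qed.

(** * Sums over isomorphism classes *)

Section TreeClassSums.

Lemma repr_piP n (T : rtree 'I_n) : isomorphic (repr (\pi_(tree_class n) T)) T.
Proof. by apply/(@eqmodP _ (iso_equiv n)); rewrite reprK. Qed.

Lemma isomorphic_repr_pi n (T : rtree 'I_n) (c : tree_class n) :
  isomorphic (repr c) T = (c == \pi_(tree_class n) T).
Proof.
apply/idP/eqP => [cT|->]; last exact: repr_piP.
by rewrite -[LHS]reprK; apply/(@eqmodP _ (iso_equiv n)).
Qed.

(** Exactly one class, in degree [#|V|], has representatives isomorphic to [T], so the indicator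
    selects a single term. *)
Lemma sum_tree_class (R : nzRingType) (V : finType) (T : rtree V) N
    (X : forall n, tree_class n -> R) (Y : R) :
    (#|V| <= N)%N ->
    (forall n (c : tree_class n), isomorphic (repr c) T -> X n c = Y) ->
  \sum_(n < N.+1) \sum_(c : tree_class n) X n c * (isomorphic (repr c) T)%:R = Y.
Proof.
rewrite -ltnS => lt_VN XY; have [T' TT'] := ordinal_representative T.
rewrite (bigD1 (Ordinal lt_VN)) //= [X in _ + X]big1 ?addr0; last first.
  move=> n Nn; rewrite big1 // => c _; case: (boolP (isomorphic _ _)) => [|_].
    by move/isomorphic_card; rewrite card_ord => E; rewrite -val_eqE /= E eqxx in Nn.
  by rewrite mulr0.
rewrite (bigD1 (\pi_(tree_class #|V|) T')) //= big1 ?addr0.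
  have cT := isomorphic_trans (repr_piP T') TT'.
  by rewrite cT mulr1; apply: XY.
move=> c Nc; case: (boolP (isomorphic _ _)) => [cT|]; last by rewrite mulr0.
case/eqP: Nc; apply/eqP; rewrite -isomorphic_repr_pi.
exact/(isomorphic_trans cT)/isomorphic_sym.
Qed.

Lemma sum_factor (R : comNzRingType) (I J W : finType) (Q : pred W)
    (a : W -> I -> R) (b : W -> J -> R) :
  \sum_i \sum_j \sum_(w | Q w) a w i * b w j =
  \sum_(w | Q w) (\sum_i a w i) * (\sum_j b w j).
Proof.
under eq_bigr => i _ do rewrite exchange_big /=.
rewrite exchange_big /=; apply: eq_bigr => w _; rewrite mulr_suml.
by apply: eq_bigr => i _; rewrite mulr_sumr.
Qed.

End TreeClassSums.

(** Used with [a1], [a2] automorphism counts, [b1], [b2] their inverses, [x1], [x2] values attached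
    to the trees, and [i1], [i2] isomorphism indicators. *)
Lemma cancel_factors (R : comNzRingType) (a1 b1 a2 b2 x1 x2 i1 i2 : R) :
  b1 * a1 = 1 -> b2 * a2 = 1 ->
  b1 * x1 * (b2 * x2) * (i1 * a1 * (i2 * a2)) = x1 * i1 * (x2 * i2).
Proof.
move=> E1 E2; transitivity ((b1 * a1) * (b2 * a2) * (x1 * i1 * (x2 * i2))).
  by ring.
by rewrite E1 E2 !mul1r.
Qed.

Section Solution.

Variable K : fieldType.
Hypothesis char0 : [pchar K] =i pred0.

Definition tree_flow : tree_series {poly K} := fun n c =>
  #|tree_aut (repr c)|%:R^-1 *: tpoly K (repr c).

Lemma card_aut_neq0 (V : finType) (T : rtree V) : #|tree_aut T|%:R != 0 :> K.
Proof. by rewrite -(prednK (card_aut_gt0 T)) char0_natS_neq0. Qed.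

(** Matches the initial condition with [gpoly_at0], whose predicate is [predT] here; hence the
    conjunct [true]. *)
Lemma single_vertexP (V : finType) (T : rtree V) :
  isomorphic single_vertex T = [forall u, ~~ (child T u (troot T) && true)].
Proof.
apply/idP/forallP => [/isomorphicP[f /isosP[_ fS fr _]] u|N].
  have [[] ->] := fS u; have [[] ->] := fS (troot T).
  by rewrite andbT; apply/negP => /child_neq; rewrite eqxx.
have allr v : v = troot T.
  apply/eqP; case: (boolP (v == _)) => // Nv.
  by have /andP[bv _] := branchP (desc_root T v) Nv; have := N (branch T (troot T) v); rewrite bv.
apply/isomorphicP; exists [ffun=> troot T]; apply/isosP; split=> [[] [] //|v||v].
- by exists tt; rewrite ffunE.
- by rewrite ffunE.
- by rewrite !ffunE parent_root.
Qed.

Lemma card_aut_single_vertex : #|tree_aut single_vertex| = 1%N.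
Proof.
apply/eqP; rewrite eqn_leq card_aut_gt0 andbT; apply: leq_trans (max_card _) _.
by rewrite card_ffun card_unit.
Qed.

Lemma tree_flow_at0 n (c : tree_class n) : (tree_flow c).[0] = bullet K n c.
Proof.
rewrite hornerZ /tpoly gpoly_at0 -single_vertexP /bullet /tree_elt.
have [E|_] := boolP (isomorphic _ _); last by rewrite mulr0.
by rewrite -(card_aut_iso E) card_aut_single_vertex invr1 mulr1.
Qed.

Lemma deriv_tree_flow n (c : tree_class n) :
  (tree_flow c)^`() = prelie (fun m c' => (todd (tree_flow c'))%:P) tree_flow c.
Proof.
set T := repr c; have aT := card_aut_neq0 T.
(* [A w] and [B w] test whether given classes are those of the two components at the edge above [w].
   Summed over all classes, they give the two factors in [deriv_tpoly]. *)
pose A (w : 'I_n) (m : nat) (c1 : tree_class m) : {poly K} :=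
  (todd (tpoly K (repr c1)))%:P * (isomorphic (repr c1) (branch_tree T w))%:R.
pose B (w : 'I_n) (m : nat) (c2 : tree_class m) : {poly K} :=
  tpoly K (repr c2) * (isomorphic (repr c2) (trunk_tree T w))%:R.
have sumA w : \sum_(m < n.+1) \sum_(c1 : tree_class m) A w m c1
            = (todd (tpoly K (branch_tree T w)))%:P.
  apply: (@sum_tree_class _ _ _ _ (fun m c1 => (todd (tpoly K (repr c1)))%:P)).
    by rewrite card_sig -[X in (_ <= X)%N](card_ord n) max_card.
  by move=> m c1 /(tpoly_iso K) ->.
have sumB w : \sum_(m < n.+1) \sum_(c2 : tree_class m) B w m c2
            = tpoly K (trunk_tree T w).
  apply: (@sum_tree_class _ _ _ _ (fun m c2 => tpoly K (repr c2))).
    by rewrite card_sig -[X in (_ <= X)%N](card_ord n) max_card.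
  by move=> m c1 /(tpoly_iso K) ->.
(* Multiplied by |Aut T|, the number of [v] whose grafting is isomorphic to [T] becomes a number of
   isomorphisms, which splits over the edges of [T]. The automorphism factors of [c1] and [c2] then
   cancel. *)
have term n1 n2 (c1 : tree_class n1) (c2 : tree_class n2) :
    (todd (tree_flow c1))%:P * tree_flow c2 *
      \sum_v tree_elt {poly K} (graft (repr c1) v (repr c2)) c
    = #|tree_aut T|%:R^-1 *: \sum_(w | w != troot T) A w n1 c1 * B w n2 c2.
  have -> : \sum_v tree_elt {poly K} (graft (repr c1) v (repr c2)) c =
      #|tree_aut T|%:R^-1 *:
        (\sum_v #|isos (graft (repr c1) v (repr c2)) T|)%N%:R.
    rewrite natr_sum scaler_sumr; apply: eq_bigr => v _.
    rewrite card_isos_target natrM mulr_natr -scaler_nat.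
    by rewrite scalerA mulVf // scale1r.
  rewrite -scalerAr sum_card_graft_isos natr_sum mulr_sumr; congr (_ *: _).
  have -> : (todd (tree_flow c1))%:P =
      (#|tree_aut (repr c1)|%:R^-1)%:P * (todd (tpoly K (repr c1)))%:P.
    by rewrite (toddZ char0) polyCM.
  have -> : tree_flow c2 = (#|tree_aut (repr c2)|%:R^-1)%:P * tpoly K (repr c2).
    by rewrite mul_polyC.
  apply: eq_bigr => w _; rewrite natrM.
  rewrite (card_isos_source (repr c1)) (card_isos_source (repr c2)) 2!natrM.
  rewrite /A /B; apply: cancel_factors; rewrite -polyC_natr -polyCM mulVf //;
    exact: card_aut_neq0.
rewrite derivZ deriv_tpoly // /prelie; apply: esym.
(* The scalar 1/|Aut T| is pulled out of the four sums; for each [w] the sums over the first and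
   second class then separate. *)
under eq_bigr => n1 _ do under eq_bigr => n2 _ do
  under eq_bigr => c1 _ do under eq_bigr => c2 _ do rewrite term.
under eq_bigr => n1 _ do under eq_bigr => n2 _ do
  under eq_bigr => c1 _ do rewrite -scaler_sumr.
under eq_bigr => n1 _ do under eq_bigr => n2 _ do rewrite -scaler_sumr sum_factor.
under eq_bigr => n1 _ do rewrite -scaler_sumr.
rewrite -scaler_sumr; congr (_ *: _).
rewrite (sum_factor (fun w => w != troot T)
  (fun w (n1 : 'I_n.+1) => \sum_(c1 : tree_class n1) A w n1 c1)
  (fun w (n2 : 'I_n.+1) => \sum_(c2 : tree_class n2) B w n2 c2)).
by apply: eq_bigr => w _; rewrite sumA sumB mul_polyC.
Qed.

Lemma tree_flow_solution : tree_solution tree_flow.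
Proof. by split=> n c; [exact: deriv_tree_flow | exact: tree_flow_at0]. Qed.

Lemma tree_binomE (P : tree_series {poly K}) n (T : rtree 'I_n) :
  tree_solution P -> tree_binom P T = tpoly K T.
Proof.
move=> P_sol; rewrite /tree_binom (tree_solution_unique char0 P_sol tree_flow_solution).
have piT := repr_piP T.
by rewrite /tree_flow (tpoly_iso K piT) (card_aut_iso piT) scalerA mulfV ?scale1r ?card_aut_neq0.
Qed.

Lemma tpoly_binomial (V : finType) (T : rtree V) :
  tpoly K T = \sum_(tree_height T <= k < #|V|)
                #|complete_decorations T k|%:R *: poly_binom K k.
Proof.
apply: (eq_poly_nat char0) => i; rewrite (tpoly_nat _ char0) horner_sum.
rewrite -sum_complete_decorations natr_sum; apply: eq_bigr => k _.
by rewrite hornerZ (poly_binom_nat char0) natrM.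
Qed.

End Solution.

Theorem theorem2p26 (K : fieldType) (char0 : [pchar K] =i pred0)
    (P : tree_series {poly K}) (P_sol : tree_solution P)
    (n : nat) (T : rtree 'I_n) :
  [/\ (forall i : nat, (tree_binom P T).[i%:R] = #|decorations T i|%:R)
        /\ (forall q : {poly K},
              (forall i : nat, q.[i%:R] = #|decorations T i|%:R) ->
              q = tree_binom P T),
      tree_binom P T =
        \sum_(tree_height T <= k < n)
          #|complete_decorations T k|%:R *: poly_binom K k
    & tree_bernoulli P T =
        \sum_(tree_height T <= k < n)
          (-1) ^+ k / k.+1%:R * #|complete_decorations T k|%:R].
Proof.
rewrite /tree_bernoulli (tree_binomE char0) //.
have E := tpoly_binomial char0 T; rewrite card_ord in E.
split=> //; first split=> [i|q Eq]; first exact: tpoly_nat.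
  by apply: (eq_poly_nat char0) => i; rewrite Eq tpoly_nat.
rewrite E (todd_sum char0); apply: eq_bigr => k _.
by rewrite (toddZ char0) (todd_poly_binom char0) mulrC.
Qed.
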